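(* Let $\alpha > 1$ and $\lambda > 0$ be real numbers and let $n$ be an integer with $n \ge \alpha + 1$. Then $$\inf_{(x_1,\dots,x_n)\in H_\lambda} F_\alpha(x_1,\dots,x_n) = \min\left(1, \frac{n}{(1+\lambda)^\alpha}\right).$$
   Context: For a positive integer $n$, a real number $\alpha$ and a real number $\lambda>0$, define $$F_\alpha(x_1,x_2,\dots,x_n)=\sum_{i=1}^{n}\frac{1}{(1+x_i)^\alpha}$$ and $$H_\lambda=\{(x_1,x_2,\dots,x_n)\in\mathbb{R}^n : x_1x_2\cdots x_n=\lambda^n,\ x_1,x_2,\dots,x_n>0\}.$$ *)

(* Defs.v *)
From mathcomp Require Import all_boot all_order all_algebra.
From mathcomp Require Import all_classical all_reals all_analysis.

Set Implicit Arguments.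
Unset Strict Implicit.
Unset Printing Implicit Defensive.

Import Order.TTheory GRing.Theory Num.Theory.

Local Open Scope classical_set_scope.
Local Open Scope ring_scope.

(* The real power [a `^ r] is only evaluated at bases [1 + x] with [0 < x],
   where it is the usual [expR (r * ln a)]. *)
Definition F (R : realType) (n : nat) (alpha : R) (x : 'rV[R]_n) : R :=
  \sum_(i < n) 1 / (1 + x ord0 i) `^ alpha.

Definition H (R : realType) (n : nat) (lambda : R) : set 'rV[R]_n :=
  [set x | \prod_(i < n) x ord0 i = lambda ^+ n /\
           forall i : 'I_n, 0 < x ord0 i].

(* Main.v *)
(* Put y_i = (1 + x_i)^(-a), b = 1/a and g(y) = ln (y^(-b) - 1) = ln x_i, so that
   F = s := sum y_i.  If s < 1, the lower bound n / (1 + lambda)^a <= s amounts to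
   sum g(y_i) >= n g(s/n).  The function g is convex near 0 and concave near 1, with
   g' = -b / q for q(y) = y - y^(1+b).  The key fact is that q(z) <= q(y) as soon
   as 0 < z <= y and y + a z <= 1; it follows from the secant inequality
   y^(1+b) - z^(1+b) <= (y - z) (y + a z)^b.  Let y_1 be the largest of the y_i
   and z the mean of the n - 1 >= a others.  Then y_i + a z <= y_1 + (n-1) z = s <= 1,
   so the tangent to g at z lies below g at every y_i, which allows replacing
   y_2, ..., y_n by z; the same fact shows that
   t |-> g(s - (n-1) t) + (n-1) g(t) is nonincreasing up to t = s/n.
   The value 1 is approached when all coordinates but one tend to infinity. *)
Require Import Defs.
From mathcomp Require Import all_boot all_order all_algebra.
From mathcomp Require Import all_classical all_reals all_analysis.
From mathcomp Require Import ring lra.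

Set Implicit Arguments.
Unset Strict Implicit.
Unset Printing Implicit Defensive.

Import Order.TTheory GRing.Theory Num.Theory.
Import numFieldNormedType.Exports.

Local Open Scope classical_set_scope.
Local Open Scope ring_scope.

(** * Tangent and secant inequalities for real powers *)

Section PowerInequalities.
Context {R : realType}.

Lemma MVT_derive (f df : R -> R) (u v : R) : u <= v ->
  (forall x, u <= x <= v -> is_derive x 1 f (df x)) ->
  exists2 c, u <= c <= v & f v - f u = df c * (v - u).
Proof.
move=> uv fdf; have fdf' x : x \in `[u, v]%R -> is_derive x 1 f (df x).
  by rewrite in_itv/=; exact: fdf.
have fc : {within `[u, v], continuous f}.
  by apply: derivable_within_continuous => x /fdf'[].
have fdfo x : x \in `]u, v[%R -> is_derive x 1 f (df x).
  by move=> xuv; apply: fdf'; exact: subset_itv_oo_cc.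
have [c] := MVT_segment uv fdfo fc.
by rewrite in_itv/= => cuv E; exists c.
Qed.

Lemma powR_tangent (b y w : R) : 0 < b < 1 -> 0 < y -> 0 < w ->
  y `^ b <= w `^ (b - 1) * (w + b * (y - w)).
Proof.
move=> /andP[b0 b1] y0 w0.
have r0 : 0 < y / w by rewrite divr_gt0.
have c0 : 0 < 1 - b by rewrite subr_gt0.
(* Young's inequality with exponents 1/b and 1/(1-b), which bounds (y/w)^b by b (y/w) + (1 - b). *)
have := @conjugate_powR R ((y / w) `^ b) 1 b^-1 (1 - b)^-1.
rewrite !invrK !invr_gt0 mulr1 powR1 mul1r -powRrM divff ?gt_eqF//.
rewrite powRr1 ?(ltW r0)// => /(_ (powR_ge0 _ _) ler01 b0 c0) H.
have {}H : (y / w) `^ b <= y / w * b + (1 - b) by apply: H; lra.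
have -> : y `^ b = (y / w) `^ b * w `^ b.
  by rewrite -powRM ?(ltW r0) ?(ltW w0)// divfK// gt_eqF.
rewrite -(mulr_powRB1 (ltW w0) b0) mulrA [leRHS]mulrC.
rewrite ler_wpM2r ?powR_ge0//.
have -> : w + b * (y - w) = (y / w * b + (1 - b)) * w.
  by field; rewrite gt_eqF.
by rewrite ler_wpM2r// ltW.
Qed.

Lemma powR_secant (a y z : R) : 1 < a -> 0 < z -> z <= y ->
  y * y `^ a^-1 - z * z `^ a^-1 <= (y - z) * (y + a * z) `^ a^-1.
Proof.
move=> a1 z0 zy; set b := a^-1.
have b01 : 0 < b < 1 by rewrite invr_gt0 invf_lt1; lra.
have ab : a * b = 1 by rewrite divff// gt_eqF; lra.
pose h (t : R) := (t - z) * (t + a * z) `^ b - t * t `^ b.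
pose dh (t : R) := (t + a * z) `^ (b - 1) * ((t + a * z) + b * (t - z))
   - (1 + b) * t `^ b.
have hdh x : z <= x <= y -> is_derive x 1 h (dh x).
  move=> /andP[zx _].
  have x0 : 0 < x by lra.
  have w0 : 0 < x + a * z by nra.
  have D1 := is_derive1_powR b x0.
  have D2 : is_derive x 1 (fun t => (t + a * z) `^ b)
      (b * (x + a * z) `^ (b - 1)).
    have D := is_derive1_powR b w0.
    have D' : is_derive x 1 (fun t : R => t + a * z) (1 : R).
      by apply: is_derive_eq; rewrite addr0.
    rewrite -[X in is_derive _ _ _ X]mulr1.
    exact (@is_derive1_comp R (fun t => t `^ b) (fun t => t + a * z) _ _ _ D D').
  apply: is_derive_eq.
  rewrite /dh /= /GRing.scale/=.
  have [b0 _] := andP b01.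
  rewrite -(mulr_powRB1 (ltW x0) b0) -(mulr_powRB1 (ltW w0) b0).
  ring.
have [c /andP[zc cy]] := MVT_derive zy hdh.
suff dhc : 0 <= dh c.
  by rewrite /h subrr mul0r => E; have := mulr_ge0 dhc (ltac:(lra) : 0 <= y - z); lra.
have c0 : 0 < c by lra.
have w0 : 0 < c + a * z by nra.
rewrite /dh subr_ge0.
have := powR_tangent b01 c0 w0.
set W := _ `^ (b - 1) => H.
(* Since a b = 1, [dh c >= 0] is exactly 1 + b times the tangent inequality. *)
have -> : c + a * z + b * (c - z) = (1 + b) * (c + a * z + b * (c - (c + a * z))).
  have -> : c + a * z + b * (c - (c + a * z)) = c + a * z - (a * b) * z by ring.
  rewrite ab.
  have -> : (1 + b) * (c + a * z - 1 * z) = c + a * z + b * c - z - b * z + (a * b) * z by ring.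
  by rewrite ab; ring.
rewrite mulrCA ler_wpM2l//; lra.
Qed.

End PowerInequalities.

(** * The function g of the substitution and its slopes *)

Section ConcaveConvexLogarithm.
Context {R : realType}.

(* If [y = (1 + x) `^ (- a)] then [lnx a y = ln x], so that [x_1 ... x_n]
   becomes a sum while [F] becomes [y_1 + ... + y_n]. *)
Definition lnx (a y : R) := ln (1 - y `^ a^-1) - a^-1 * ln y.

(* [- a^-1 / gap a] is the derivative of [lnx a]. *)
Definition gap (a y : R) := y - y * y `^ a^-1.

Lemma powRV_lt1 (a y : R) : 0 < a -> 0 < y < 1 -> y `^ a^-1 < 1.
Proof.
move=> a0 /andP[y0 y1]; have := @gt0_ltr_powR R a^-1.
rewrite invr_gt0 a0 => /(_ isT y 1).
by rewrite !qualifE/= ler01 (ltW y0) powR1; apply.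
Qed.

Lemma gap_gt0 (a y : R) : 0 < a -> 0 < y < 1 -> 0 < gap a y.
Proof.
move=> a0 y01; rewrite subr_gt0 gtr_pMr; first exact: powRV_lt1.
by case/andP: y01.
Qed.

Lemma gap_le (a y z : R) : 1 < a -> 0 < z -> z <= y -> y + a * z <= 1 ->
  gap a z <= gap a y.
Proof.
move=> a1 z0 zy yz1; have := powR_secant a1 z0 zy.
have : (y + a * z) `^ a^-1 <= 1.
  have w0 : 0 <= y + a * z by nra.
  have b0 : 0 <= a^-1 by rewrite invr_ge0; lra.
  have := ge0_ler_powR b0 (x := y + a * z) (y := 1).
  by rewrite powR1 !qualifE/= ler01 w0; apply.
rewrite /gap; set W := _ `^ _; nra.
Qed.

Lemma is_derive_lnx (a y : R) : 0 < a -> 0 < y < 1 ->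
  is_derive y 1 (lnx a) (- (a^-1 / gap a y)).
Proof.
move=> a0 y01; have [y0 y1] := andP y01; have p1 := powRV_lt1 a0 y01.
have b0 : 0 < a^-1 by rewrite invr_gt0.
have Dp := is_derive1_powR a^-1 y0.
have D1p : is_derive y 1 (fun t : R => 1 - t `^ a^-1)
    (- (a^-1 * y `^ (a^-1 - 1))).
  by apply: is_derive_eq; rewrite add0r mul1r.
have p10 : 0 < 1 - y `^ a^-1 by rewrite subr_gt0.
have Dl := @is_derive1_comp R (@ln R) (fun t => 1 - t `^ a^-1) _ _ _
  (is_derive1_ln p10) D1p.
have Dy := is_derive1_ln y0.
apply: is_derive_eq.
rewrite /gap /= /GRing.scale/=.
move: p10; rewrite -(mulr_powRB1 (ltW y0) b0); set w := _ `^ _ => p10.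
field; rewrite ?gt_eqF//=.
by rewrite subr_gt0 gtr_pMr//; lra.
Qed.

(* [lnx a] is convex only near 0, but by [gap_le] its slopes between [z] and [y]
   still compare with the slope at [z] as they would for a convex function. *)
Lemma lnx_tangent (a y z : R) : 1 < a -> 0 < y -> 0 < z -> (1 + a) * z <= 1 ->
  y + a * z <= 1 -> lnx a z - a^-1 / gap a z * (y - z) <= lnx a y.
Proof.
move=> a1 y0 z0 az1 yz1; have a0 : 0 < a by lra.
have b0 : 0 < a^-1 by rewrite invr_gt0.
have az : 0 < a * z by rewrite mulr_gt0.
have gz0 : 0 < gap a z by apply: gap_gt0 => //; lra.
have [zy|/ltW yz] := leP z y.
- have D x : z <= x <= y -> is_derive x 1 (lnx a) (- (a^-1 / gap a x)).
    by move=> xx; apply: is_derive_lnx; lra.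
  have [c /andP[zc cy] E] := MVT_derive zy D.
  have gc : gap a z <= gap a c by apply: gap_le => //; lra.
  have : a^-1 / gap a c <= a^-1 / gap a z.
    by rewrite ler_pM2l// lef_pV2 ?qualifE/= ?(lt_le_trans gz0).
  move: E; move: (_ / gap a c) (_ / gap a z) => A B E AB.
  have := ler_wpM2r (ltac:(lra) : 0 <= y - z) AB; lra.
- have D x : y <= x <= z -> is_derive x 1 (lnx a) (- (a^-1 / gap a x)).
    by move=> xx; apply: is_derive_lnx; lra.
  have [c /andP[yc cz] E] := MVT_derive yz D.
  have gc0 : 0 < gap a c by apply: gap_gt0 => //; lra.
  (* Here [z] is the larger point, and [z + a * c <= (1 + a) * z <= 1]. *)
  have gc : gap a c <= gap a z by apply: gap_le => //; nra.
  have : a^-1 / gap a z <= a^-1 / gap a c.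
    by rewrite ler_pM2l// lef_pV2 ?qualifE.
  move: E; move: (_ / gap a c) (_ / gap a z) => A B E AB.
  have := ler_wpM2r (ltac:(lra) : 0 <= z - y) AB; lra.
Qed.

(** The [k] equal values [t] rise from [z] to the mean [m] at fixed total [s]. The derivative is
    nonpositive by [gap_le], as [(s - k * t) + a * t <= s < 1]. *)
Lemma lnx_two_values (a k s z : R) : 1 < a -> a <= k -> s < 1 -> 0 < z ->
  (k + 1) * z <= s ->
  (k + 1) * lnx a (s / (k + 1)) <= lnx a (s - k * z) + k * lnx a z.
Proof.
move=> a1 ak s1 z0 kzs; have k0 : 0 < k by lra.
have k10 : 0 < k + 1 by lra.
have b0 : 0 < a^-1 by rewrite invr_gt0; lra.
set m := s / _; have ms : (k + 1) * m = s by rewrite mulrC divfK// gt_eqF.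
have zm : z <= m by rewrite -(ler_pM2l k10) ms.
pose h (t : R) := lnx a (s - k * t) + k * lnx a t.
pose dh (t : R) := k * (a^-1 / gap a (s - k * t) - a^-1 / gap a t).
have rg t : z <= t <= m -> 0 < t /\ (k + 1) * t <= s.
  by move=> /andP[zt tm]; split; [lra|rewrite -ms ler_pM2l].
have hdh t : z <= t <= m -> is_derive t 1 h (dh t).
  move=> /rg[t0 ts]; have kt : 0 < k * t by rewrite mulr_gt0.
  have D1 : is_derive t 1 (lnx a) (- (a^-1 / gap a t)).
    by apply: is_derive_lnx; lra.
  have D2 : is_derive (s - k * t) 1 (lnx a) (- (a^-1 / gap a (s - k * t))).
    by apply: is_derive_lnx; lra.
  have D3 : is_derive t 1 (fun x : R => s - k * x) (- k).
    by apply: is_derive_eq; rewrite add0r /= /GRing.scale/= ?mulr1; ring.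
  have D4 := @is_derive1_comp R (lnx a) (fun x => s - k * x) _ _ _ D2 D3.
  apply: is_derive_eq.
  rewrite /dh /= /GRing.scale/=; ring.
have [c czm E] := MVT_derive zm hdh.
have [c0 cs] := rg _ czm.
have kc : a * c <= k * c by rewrite ler_pM2r.
have ac : 0 < a * c by rewrite mulr_gt0//; lra.
have gc : gap a c <= gap a (s - k * c) by apply: gap_le => //; lra.
have gc0 : 0 < gap a c by apply: gap_gt0 => //; lra.
have dh0 : dh c <= 0.
  rewrite /dh pmulr_rle0// subr_le0 ler_pM2l// lef_pV2 ?qualifE//=.
  exact: lt_le_trans gc.
have hle : h m - h z <= 0 by rewrite E mulr_le0_ge0// subr_ge0.
have <- : h m = (k + 1) * lnx a m.
  rewrite /h; have -> : s - k * m = m by rewrite -ms; ring.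
  ring.
by rewrite -subr_le0.
Qed.

End ConcaveConvexLogarithm.

(** * The lower bound on F and the points that show it is sharp *)

Section Minimum.
Context {R : realType}.

Lemma sumr_neq_const n (i0 : 'I_n.+2) (c : R) :
  \sum_(i < n.+2 | i != i0) c = n.+1%:R * c.
Proof. by rewrite sumr_const cardC1 card_ord mulr_natl. Qed.

Lemma lnx_sum_ge (a : R) n (y : 'I_n.+2 -> R) : 1 < a -> a <= n.+1%:R ->
  (forall i, 0 < y i) -> \sum_i y i < 1 ->
  n.+2%:R * lnx a ((\sum_i y i) / n.+2%:R) <= \sum_i lnx a (y i).
Proof.
move=> a1 an y0; set s := \sum_i y i => s1.
have [i0 ymax] : exists i0, forall i, y i <= y i0.
  by case: (@Order.TotalTheory.arg_maxP _ _ _ ord0 predT y isT) => i _ yi; exists i => j; exact: yi.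
set k : R := n.+1%:R in an *.
have kE : n.+2%:R = k + 1 by rewrite /k -natr1.
have k0 : 0 < k by lra.
pose z := (\sum_(i < n.+2 | i != i0) y i) / k.
have kz : k * z = \sum_(i < n.+2 | i != i0) y i by rewrite mulrC divfK// gt_eqF.
have sE : s = y i0 + k * z by rewrite kz /s (bigD1 i0).
have z0 : 0 < z.
  rewrite -(pmulr_rgt0 _ k0) kz.
  rewrite (bigD1 (lift i0 ord0)) 1?eq_sym ?neq_lift//=.
  by rewrite ltr_pwDl// sumr_ge0// => i _; exact: ltW.
have zy : z <= y i0.
  rewrite -(ler_pM2l k0) kz -(sumr_neq_const i0).
  by apply: ler_sum.
have az : a * z <= k * z by rewrite ler_pM2r.
have az0 : 0 < a * z by rewrite mulr_gt0//; lra.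
have kzs : (k + 1) * z <= s by lra.
rewrite kE; apply: le_trans (lnx_two_values a1 an s1 z0 kzs) _.
rewrite sE addrK (bigD1 i0)//= lerD2l.
(* The linear terms cancel in the sum because [z] is the mean of these [y i]. *)
have : \sum_(i < n.+2 | i != i0) (lnx a z - a^-1 / gap a z * (y i - z)) <=
    \sum_(i < n.+2 | i != i0) lnx a (y i).
  apply: ler_sum => i _; apply: lnx_tangent => //; first by lra.
  by have := ymax i; lra.
move: (lnx a z) => w.
by rewrite sumrB -mulr_sumr sumrB !sumr_neq_const -kz subrr mulr0 subr0.
Qed.

Lemma lnx_onex (a x : R) : 1 < a -> 0 < x -> lnx a ((1 + x) `^ a)^-1 = ln x.
Proof.
move=> a1 x0; have x10 : 0 < 1 + x by lra.
have a0 : a != 0 by rewrite gt_eqF//; lra.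
rewrite /lnx -powRN ln_powR mulrA mulrN mulVf// mulN1r opprK.
rewrite -powRrM mulNr divff// powRN powRr1 ?(ltW x10)//.
have -> : 1 - (1 + x)^-1 = x / (1 + x) by field; rewrite gt_eqF.
by rewrite lnM ?lnV ?qualifE/= ?invr_gt0// subrK.
Qed.

(** Every [y] in (0, 1) is (1 + x)^(-a) for some x > 0, so the hypothesis reads ln x <= ln l. *)
Lemma lnx_le_ln (a y l : R) : 1 < a -> 0 < l -> 0 < y < 1 -> lnx a y <= ln l ->
  ((1 + l) `^ a)^-1 <= y.
Proof.
move=> a1 l0 y01 yl; have [y0 y1] := andP y01.
have a0 : 0 < a by lra.
have p0 := powR_gt0 a^-1 y0.
have p1 := powRV_lt1 a0 y01.
pose x := (y `^ a^-1)^-1 - 1.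
have x0 : 0 < x by rewrite subr_gt0 invf_gt1.
have yE : y = ((1 + x) `^ a)^-1.
  rewrite addrC subrK -powRN -powRN -!powRrM.
  by rewrite mulrN mulNr opprK mulVf ?gt_eqF// powRr1// ltW.
move: yl; rewrite {1}yE lnx_onex// ler_ln ?qualifE// => xl.
rewrite yE lef_pV2 ?qualifE/= ?powR_gt0//; try lra.
by apply: ge0_ler_powR; rewrite ?qualifE/=; lra.
Qed.

Lemma F_ge (a l : R) n (x : 'rV[R]_n.+2) : 1 < a -> a <= n.+1%:R -> 0 < l ->
  @H R n.+2 l x -> Num.min 1 (n.+2%:R / (1 + l) `^ a) <= F a x.
Proof.
move=> a1 an l0 [xl x0]; rewrite ge_min.
have [//|s1] := leP 1 (F a x); apply/orP; right.
have x1 i : 0 < 1 + x ord0 i by have := x0 i; lra.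
pose y i := ((1 + x ord0 i) `^ a)^-1.
have FE : F a x = \sum_i y i.
  by apply: eq_bigr => i _; rewrite mul1r.
rewrite FE in s1 *.
have y0 i : 0 < y i by rewrite invr_gt0 powR_gt0.
have := lnx_sum_ge a1 an y0 s1.
have -> : \sum_i lnx a (y i) = n.+2%:R * ln l.
  rewrite mulr_natl -lnXn// -xl.
  under eq_bigr do rewrite lnx_onex//.
  (* Positivity of the partial products is carried through the induction, since [lnM] needs it. *)
  apply: proj2 (_ : 0 < \prod_i x ord0 i /\ _).
  elim/big_rec2: _ => [|i p t _ [t0 ->]]; first by rewrite ln1.
  by rewrite lnM ?qualifE/= ?mulr_gt0.
rewrite ler_pM2l// => /(lnx_le_ln a1 l0) le_mean.
rewrite mulrC -ler_pdivlMr//; apply: le_mean.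
have sy : 0 < \sum_i y i by rewrite big_ord_recl ltr_pwDl// sumr_ge0// => i _; exact: ltW.
rewrite divr_gt0//= ltr_pdivrMr// mul1r (lt_trans s1)//.
by rewrite ltr1n.
Qed.

Lemma F_const_mx (a l : R) n : 0 < l ->
  @H R n.+2 l (const_mx l) /\ F a (const_mx l : 'rV[R]_n.+2) = n.+2%:R / (1 + l) `^ a.
Proof.
move=> l0; split.
  split; last by move=> i; rewrite mxE.
  under eq_bigr do rewrite mxE.
  by rewrite prodr_const card_ord.
rewrite /F; under eq_bigr do rewrite mxE.
by rewrite sumr_const card_ord div1r mulr_natl.
Qed.

Lemma F_near1 (a l e : R) n : 1 < a -> 0 < l -> 0 < e ->
  exists2 x : 'rV[R]_n.+2, @H R n.+2 l x & F a x <= 1 + e.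
Proof.
move=> a1 l0 e0; set k : R := n.+1%:R; have k0 : 0 < k by [].
(* Each of the [k] coordinates [M] contributes at most 1 / (1 + M) < e / k; the remaining one
   restores the product and contributes at most 1. *)
pose M := k / e; have M0 : 0 < M by rewrite divr_gt0.
have c0 : 0 < l ^+ n.+2 / M ^+ n.+1 by rewrite divr_gt0// exprn_gt0.
pose x : 'rV[R]_n.+2 :=
  \row_i (if i == ord0 then l ^+ n.+2 / M ^+ n.+1 else M).
exists x.
  split; last by move=> i; rewrite mxE; case: ifP.
  rewrite big_ord_recl mxE eqxx.
  under eq_bigr do rewrite mxE eq_sym (negPf (neq_lift _ _)).
  by rewrite prodr_const card_ord divfK// gt_eqF// exprn_gt0.
rewrite /F big_ord_recl mxE eqxx.
under eq_bigr do rewrite mxE eq_sym (negPf (neq_lift _ _)).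
rewrite sumr_const card_ord -[X in _ + X]mulr_natl -/k; apply: lerD.
  rewrite mul1r invf_le1 ?powR_gt0//; last by lra.
  rewrite -[leLHS](powRr0 (1 + l ^+ n.+2 / M ^+ n.+1)) ler_powR//; lra.
rewrite mul1r ler_pdivrMr ?powR_gt0//; last by lra.
have MM : 1 + M <= (1 + M) `^ a by apply: le1r_powR; lra.
have eM : e * M = k by rewrite mulrC divfK// gt_eqF.
nra.
Qed.

End Minimum.

Theorem proposition2 (R : realType) (alpha lambda : R) (n : nat)
    (halpha : 1 < alpha) (hlambda : 0 < lambda) (hn : alpha + 1 <= n%:R) :
  inf [set F alpha x | x in @H R n lambda] =
  Num.min 1 (n%:R / (1 + lambda) `^ alpha).
Proof.
(* [n] exceeds 2 because [alpha > 1]. *)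
case: n hn => [|[|n]] hn; [by move: hn; lra|by move: hn; lra|].
have an : alpha <= n.+1%:R by move: hn; rewrite -(natr1 n.+1); lra.
have [uH uF] := F_const_mx alpha n hlambda.
have lb : lbound [set F alpha x | x in @H R n.+2 lambda]
    (Num.min 1 (n.+2%:R / (1 + lambda) `^ alpha)).
  by move=> _ [x xH <-]; exact: F_ge.
apply/eqP; rewrite eq_le; apply/andP; split; last first.
  by apply: lb_le_inf => //; exists (F alpha (const_mx lambda : 'rV_n.+2)), (const_mx lambda).
have hl : has_lbound [set F alpha x | x in @H R n.+2 lambda] by eexists; exact: lb.
(* The bound 1 is only approached, hence the slack [e]; the other value is taken at the constant
   point. *)
rewrite le_min; apply/andP; split.
  apply/ler_addgt0Pr => e e0.
  have [x xH xF] := F_near1 n halpha hlambda e0.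
  by apply: le_trans xF; apply: ge_inf => //; exists x.
by rewrite -uF; apply: ge_inf => //; exists (const_mx lambda).
Qed.
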